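(* Let $\alpha,\beta>-1$, and put $\xi=\frac{\alpha-1}{2}$, $\eta=\frac{\beta-1}{2}$. Let $a_n$, $n\ge 0$, be the reflection parameters of the Jacobi polynomials on the unit circle with parameters $\xi,\eta$, and let $a_{-1}=-1$. Let $Q_n(x)$ be the monic polynomials defined by $Q_0=1$, $Q_1(x)=x-b_0$ and $$Q_{n+1}(x)+b_nQ_n(x)+u_nQ_{n-1}(x)=xQ_n(x),\quad n\ge 1,\qquad b_n=a_n-a_{n-1},\quad u_n=1-a_{n-1}^2 .$$ Then, up to an affine change of the argument, the $Q_n$ coincide with the monic little $-1$ Jacobi polynomials with parameters $\alpha,\beta$. Explicitly, the polynomials $2^{-n}Q_n(2x)$, $n\ge 0$, are the monic polynomials orthogonal on $[-1,1]$ with respect to the weight function $$(1+x)\,(1-x^2)^{(\alpha-1)/2}\,|x|^{\beta}.$$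
   Context: The Jacobi polynomials on the unit circle with parameters $\xi,\eta>-1$ are the monic polynomials $\Phi_n(z)$ orthogonal on the unit circle with respect to $\rho(\theta)\,d\theta$, where $\rho(\theta)=(1-\cos\theta)^{\xi+1/2}(1+\cos\theta)^{\eta+1/2}$, $\theta\in[0,2\pi]$. Their reflection parameters $a_n=-\overline{\Phi_{n+1}(0)}$ are $$a_n=\frac{\eta-\xi}{n+\xi+\eta+2}\ \ (n\ge 0\text{ even}),\qquad a_n=-\frac{1+\xi+\eta}{n+\xi+\eta+2}\ \ (n\ge 1\text{ odd}).$$ The monic little $-1$ Jacobi polynomials with parameters $\alpha,\beta>-1$ are the monic orthogonal polynomials on $[-1,1]$ for the weight $(1+x)(1-x^2)^{(\alpha-1)/2}|x|^{\beta}$. *)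

(* Defs.v *)
From HB Require Import structures.
From mathcomp Require Import all_boot all_order all_algebra.
From mathcomp Require Import complex.
From mathcomp Require Import all_classical all_reals all_analysis.

Set Implicit Arguments.
Unset Strict Implicit.
Unset Printing Implicit Defensive.

Import Order.TTheory GRing.Theory Num.Theory.
Import numFieldNormedType.Exports.

Local Open Scope classical_set_scope.
Local Open Scope ring_scope.
Local Open Scope complex_scope.

Section OrthogonalPolynomials.
Variable R : realType.

Let mu := @lebesgue_measure R.

(* The condition that the products be integrable is needed because [Rintegral]
   is a total function, with junk value when the integrand is not integrable. *)
Definition monic_orthogonal (D : set R) (w : R -> R) (P : nat -> {poly R}) :
    Prop :=
  [/\ forall n, P n \is monic /\ size (P n) = n.+1,
      forall m n, mu.-integrable D
        (EFin \o (fun x => (P m).[x] * (P n).[x] * w x)),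
      forall m n, m != n ->
        \int[mu]_(x in D) ((P m).[x] * (P n).[x] * w x) = 0 &
      forall n, 0 < \int[mu]_(x in D) ((P n).[x] * (P n).[x] * w x)].

Definition expi (t : R) : R[i] := cos t +i* sin t.

Definition cintegrable (D : set R) (f : R -> R[i]) : Prop :=
  mu.-integrable D (EFin \o (fun t => complex.Re (f t))) /\
  mu.-integrable D (EFin \o (fun t => complex.Im (f t))).

Definition cintegral (D : set R) (f : R -> R[i]) : R[i] :=
  (\int[mu]_(t in D) complex.Re (f t)) +i* (\int[mu]_(t in D) complex.Im (f t)).

Definition circle_integrand (rho : R -> R) (p q : {poly R[i]}) (t : R) : R[i] :=
  p.[expi t] * (q.[expi t])^*%C * (rho t)%:C.

(* In the last clause, [0 < z] in [R[i]] says that z is real and positive. *)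
Definition monic_orthogonal_circle (rho : R -> R) (Phi : nat -> {poly R[i]}) :
    Prop :=
  let D : set R := [set` `[0, 2 * pi]] in
  [/\ forall n, Phi n \is monic /\ size (Phi n) = n.+1,
      forall m n, cintegrable D (circle_integrand rho (Phi m) (Phi n)),
      forall m n, m != n ->
        cintegral D (circle_integrand rho (Phi m) (Phi n)) = 0 &
      forall n, 0 < cintegral D (circle_integrand rho (Phi n) (Phi n))].

Definition jacobi_circle_weight (xi eta t : R) : R :=
  (1 - cos t) `^ (xi + 2^-1) * (1 + cos t) `^ (eta + 2^-1).

Definition jacobi_circle (xi eta : R) (Phi : nat -> {poly R[i]}) : Prop :=
  monic_orthogonal_circle (jacobi_circle_weight xi eta) Phi.

Definition reflection_param (Phi : nat -> {poly R[i]}) (n : nat) : R[i] :=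
  - ((Phi n.+1).[0])^*%C.

Definition little_m1_jacobi_weight (alpha beta x : R) : R :=
  (1 + x) * (1 - x ^+ 2) `^ ((alpha - 1) / 2) * `|x| `^ beta.

Definition little_m1_jacobi (alpha beta : R) (P : nat -> {poly R}) : Prop :=
  monic_orthogonal `[-1, 1] (little_m1_jacobi_weight alpha beta) P.

End OrthogonalPolynomials.

(* Main.v *)
Require Import Defs.
From HB Require Import structures.
From mathcomp Require Import all_boot all_order all_algebra.
From mathcomp Require Import complex.
From mathcomp Require Import all_classical all_reals all_analysis.
From mathcomp Require Import measurable_realfun.
From mathcomp Require Import ring lra zify.

Set Implicit Arguments.
Unset Strict Implicit.
Unset Printing Implicit Defensive.

Import Order.TTheory GRing.Theory Num.Theory.
Import numFieldNormedType.Exports.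

Local Open Scope ring_scope.
Local Open Scope complex_scope.

(** Let rho be the Jacobi weight on the circle. Its trigonometric moments are
    real, since rho (2 pi - t) = rho t, so the real parts p_n of the
    coefficients of Phi_n satisfy the same orthogonality relations, and these
    give Szego's recurrence p_(n+1) = z p_n - a_n p_n^*. By induction, the
    recurrence of the Q_n then becomes the half-angle identity
      cos (x / 2) Q_n (2 cos x) = sum_k p_(n,k) cos ((2 k + 1/2 - n) x).
    Under y = cos (t / 2), x = t / 2, the weight
    (1 + y) (1 - y^2)^((alpha - 1)/2) |y|^beta dy becomes a constant multiple of
    cos^2 (t / 4) rho(t) dt. So the Gram matrix of the Q_n is a combination of
    the moments of rho of order k + l - (n + m - 1)/2 and k - l - (n - m)/2. One
    of the two families has half-integral order, and vanishes by the symmetry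
    of rho; the other consists of scalar products of p_n with z^j, where j < n
    as soon as m < n. *)

(** * Linear functionals on polynomials and reversed polynomials *)

Section CoefficientSums.
Variable R : comNzRingType.
Implicit Types (g : nat -> R) (p q : {poly R}).

(** The linear functional with value [g i] at the monomial of degree [i]. It serves both for moments
    of the weight and for sums of cosines. *)
Definition coefsum g p := \sum_(i < size p) p`_i * g i.

Lemma coefsum_widen g p n : (size p <= n)%N ->
  coefsum g p = \sum_(i < n) p`_i * g i.
Proof.
move=> pn; rewrite /coefsum (big_ord_widen n (fun i => p`_i * g i)) //.
rewrite big_mkcond.
apply: eq_bigr => i _; case: ltnP => // pi.
by rewrite nth_default ?mul0r.
Qed.

Lemma eq_coefsum g h p : g =1 h -> coefsum g p = coefsum h p.
Proof. by move=> gh; apply: eq_bigr => i _; rewrite gh. Qed.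

Lemma coefsumD g p q : coefsum g (p + q) = coefsum g p + coefsum g q.
Proof.
pose n := maxn (size p) (size q).
rewrite !(@coefsum_widen _ _ n) ?size_polyD ?leq_maxl ?leq_maxr //.
by rewrite -big_split; apply: eq_bigr => i _; rewrite coefD mulrDl.
Qed.

Lemma coefsumZ g a p : coefsum g (a *: p) = a * coefsum g p.
Proof.
rewrite (@coefsum_widen _ _ (size p)) ?size_scale_leq // mulr_sumr.
by apply: eq_bigr => i _; rewrite coefZ mulrA.
Qed.

Lemma coefsumB g p q : coefsum g (p - q) = coefsum g p - coefsum g q.
Proof. by rewrite coefsumD -scaleN1r coefsumZ mulN1r. Qed.

Lemma coefsumMX g p : coefsum g ('X * p) = coefsum (g \o succn) p.
Proof.
rewrite (@coefsum_widen _ _ (size p).+1); last first.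
  by rewrite mulrC (leq_trans (size_polyMleq _ _)) // size_polyX addn2.
rewrite big_ord_recl coefXM mul0r add0r.
by apply: eq_bigr => i _; rewrite coefXM.
Qed.

Lemma coefsum_comb g h a b p :
  coefsum (fun i => a * g i + b * h i) p = a * coefsum g p + b * coefsum h p.
Proof.
rewrite !mulr_sumr -big_split; apply: eq_bigr => i _ /=; ring.
Qed.

(** Szego's reversed polynomial z^n p(1/z), for real coefficients and degree at most [n]. *)
Definition reverse_poly n p := \poly_(i < n.+1) p`_(n - i).

Lemma coefsum_reverse g n p : (size p <= n.+1)%N ->
  coefsum g (reverse_poly n p) = coefsum (fun i => g (n - i)%N) p.
Proof.
move=> pn; rewrite !(@coefsum_widen _ _ n.+1) ?size_poly //.
rewrite (reindex_inj rev_ord_inj) /=; apply: eq_bigr => -[i /= lin] _.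
by rewrite coef_poly subSS ltnS leq_subr; congr (p`_ _ * _); lia.
Qed.

End CoefficientSums.

(** * Szego's recurrence from a real symmetric Toeplitz form *)

Section SzegoRecurrence.
Variables (R : realFieldType) (c : R -> R) (p : nat -> {poly R}).
Hypothesis c_even : forall x, c (- x) = c x.
Hypothesis p_monic : forall n, p n \is monic.
Hypothesis size_p : forall n, size (p n) = n.+1.

(** The scalar product of [q] with z^j when [c] gives the moments. The argument of [c] is real
    because the same moment function is later evaluated at half-integers. *)
Definition toeplitz (q : {poly R}) (j : nat) : R :=
  coefsum (fun i => c (i%:R - j%:R)) q.

Hypothesis p_orth : forall n j, (j < n)%N -> toeplitz (p n) j = 0.
Hypothesis p_norm : forall n, 0 < toeplitz (p n) n.

Let lead_p n : (p n)`_n = 1.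
Proof. by have /monicP := p_monic n; rewrite lead_coefE size_p. Qed.

(** Pair [q], of degree [d], with [p d]. The pairing is 0 by assumption; by orthogonality of [p d]
    it is also the leading coefficient of [q] times a positive norm. *)
Lemma toeplitz_inj n (q : {poly R}) : (size q <= n)%N ->
  (forall j, (j < n)%N -> toeplitz q j = 0) -> q = 0.
Proof.
move=> qn q0; apply/eqP; apply: contraT => qN0.
set d := (size q).-1.
have sq : size q = d.+1 by rewrite /d prednK // size_poly_gt0.
have : \sum_(j < d.+1) (p d)`_j * toeplitz q j = 0.
  by apply: big1 => j _; rewrite q0 ?mulr0 //; case: j => j /=; lia.
rewrite /toeplitz /coefsum sq.
under eq_bigr do rewrite mulr_sumr.
rewrite exchange_big /= => E.
(* Evenness of [c] makes the form symmetric, so [q] and [p d] exchange roles. *)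
have {E} : \sum_(i < d.+1) q`_i * toeplitz (p d) i = 0.
  rewrite -[RHS]E; apply: eq_bigr => i _.
  rewrite /toeplitz /coefsum size_p mulr_sumr; apply: eq_bigr => j _.
  by rewrite -(c_even (i%:R - j%:R)) opprB; ring.
rewrite big_ord_recr big1 /=; last first.
  by move=> i _; rewrite p_orth ?mulr0.
rewrite add0r => /eqP; rewrite mulf_eq0 (gt_eqF (p_norm _)) orbF.
by rewrite -lead_coefE lead_coef_eq0 (negbTE qN0).
Qed.

Lemma szego_recurrence n :
  p n.+1 = 'X * p n + (p n.+1)`_0 *: reverse_poly n (p n).
Proof.
(* The difference [e] of the two sides vanishes at 0, and [e / 'X], of degree
   less than [n], is orthogonal to all polynomials of degree less than [n]. *)
apply/eqP; rewrite -subr_eq0; set e := (X in X == 0).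
have eX : e = 'X * drop_poly 1 e.
  rewrite mulrC -{1}(poly_take_drop 1 e) expr1.
  suff -> : take_poly 1 e = 0 by rewrite add0r.
  apply/polyP => i; rewrite coef_take_poly coef0; case: i => //=.
  by rewrite /e coefB coefD coefXM coefZ coef_poly subn0 lead_p /=; ring.
suff e0 : drop_poly 1 e = 0 by rewrite eX e0 mulr0.
apply: (@toeplitz_inj n).
  apply/leq_sizeP => j nj; rewrite coef_drop_poly /e addn1.
  rewrite coefB coefD coefXM coefZ coef_poly /=.
  (* For [j = n] the leading coefficients of [p n.+1] and ['X * p n] cancel, both being 1; beyond
     that, every coefficient vanishes. *)
  have [->|jn] := eqVneq j n.
    by rewrite !lead_p ltnn; ring.
  rewrite ifN; last by lia.
  have lt_nj : (n < j)%N by lia.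
  have pE k i : (k < i)%N -> (p k)`_i = 0.
    by move=> ki; rewrite nth_default ?size_p.
  by rewrite (pE n.+1 j.+1) // (pE n j) //; ring.
move=> j jn.
(* Multiplication by z is an isometry for a Toeplitz form. *)
have -> : toeplitz (drop_poly 1 e) j = toeplitz e j.+1.
  rewrite [in RHS]eX /toeplitz coefsumMX; apply: eq_coefsum => i /=.
  by congr c; rewrite -!natr1; ring.
rewrite {1}/toeplitz /e coefsumB coefsumD coefsumZ.
rewrite coefsumMX coefsum_reverse ?size_p // -!/(toeplitz (p n.+1) _).
have -> : coefsum ((fun i => c (i%:R - j.+1%:R)) \o succn) (p n) =
    toeplitz (p n) j.
  by apply: eq_coefsum => i /=; congr c; rewrite -!natr1; ring.
(* Reversal turns the product with z^(j+1) into the product of [p n] with z^(n-j-1), again of degree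
   below [n]. *)
have -> : coefsum (fun i => c ((n - i)%:R - j.+1%:R)) (p n) =
    toeplitz (p n) (n - j.+1)%N.
  apply: eq_bigr => -[i /=]; rewrite size_p => lin _; congr (_ * _).
  by rewrite -[RHS]c_even !natrB //; congr c; ring.
by rewrite !p_orth; [ring | lia | lia | lia].
Qed.

End SzegoRecurrence.

(** * The half-angle identity for the polynomials [Q n] *)

Section CosineSums.
Variable R : realType.
Implicit Types (p : {poly R}) (r x y : R).

Lemma cosM2 x y : 2 * (cos x * cos y) = cos (x + y) + cos (x - y).
Proof. by rewrite cosB cosD; ring. Qed.

(** The real part of e^(irx) p(e^(2ix)) for real [p]; thus [x] is half the angle on the circle. *)
Definition cossum x r p := coefsum (fun k => cos ((k%:R * 2 + r) * x)) p.

Lemma cossumMX x r p : cossum x r ('X * p) = cossum x (r + 2) p.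
Proof.
rewrite /cossum coefsumMX; apply: eq_coefsum => k /=.
by congr cos; rewrite -natr1; ring.
Qed.

(** Since 2(n - k) + r = -(2k - 2n - r) and the cosine is even, reversal only changes the shift
    [r]. *)
Lemma cossum_reverse x r n p : (size p <= n.+1)%N ->
  cossum x r (reverse_poly n p) = cossum x (- (n%:R * 2) - r) p.
Proof.
move=> pn; rewrite /cossum coefsum_reverse // !(coefsum_widen _ pn).
apply: eq_bigr => -[k /= kn] _; congr (_ * _).
by rewrite -cosN natrB //; congr cos; ring.
Qed.

Lemma cossumMcos x r p :
  2 * cos x * cossum x r p = cossum x (r + 1) p + cossum x (r - 1) p.
Proof.
rewrite -[X in X + _]mul1r -[X in _ + X]mul1r -coefsum_comb mulr_sumr.
apply: eq_bigr => k _ /=; rewrite mulrCA -mulrA (mulrC (cos x)) cosM2.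
by congr (_ * _); rewrite !mul1r; congr (cos _ + cos _); ring.
Qed.

Variables (a : nat -> R) (p Q : nat -> {poly R}).
Hypothesis p0 : p 0%N = 1.
Hypothesis size_p : forall n, size (p n) = n.+1.
Hypothesis pS : forall n, p n.+1 = 'X * p n - a n *: reverse_poly n (p n).
Hypothesis Q0 : Q 0%N = 1.
Hypothesis Q1 : Q 1%N = 'X - (a 0%N + 1)%:P.
Hypothesis QSS : forall n, Q n.+2 + (a n.+1 - a n) *: Q n.+1 +
  (1 - a n ^+ 2) *: Q n = 'X * Q n.+1.

Let cossumS x r n : cossum x r (p n.+1) =
  cossum x (r + 2) (p n) - a n * cossum x (- (n%:R * 2) - r) (p n).
Proof.
rewrite pS -scaleNr /cossum coefsumD coefsumZ mulNr -!/(cossum _ _ _).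
by rewrite cossumMX cossum_reverse ?size_p.
Qed.

(** Two consecutive indices are carried through the induction, since the recurrence for [Q] has
    order two. Multiplication by 2 cos x moves the shift by 1 both ways, and Szego's recurrence
    brings the terms back together. *)
Lemma horner_cossum n x :
  cos (x / 2) * (Q n).[2 * cos x] = cossum x (2^-1 - n%:R) (p n).
Proof.
have c0 r : cossum x r (p 0%N) = cos (r * x).
  rewrite p0 /cossum /coefsum size_poly1 big_ord1 coef1 eqxx mul1r.
  by rewrite mul0r add0r.
suff: cos (x / 2) * (Q n).[2 * cos x] = cossum x (2^-1 - n%:R) (p n) /\
  cos (x / 2) * (Q n.+1).[2 * cos x] = cossum x (2^-1 - n.+1%:R) (p n.+1).
  by case.
elim: n => [|n [IHn IHSn]]; last split=> //.
  (* As 2 cos x cos(x/2) = cos(3x/2) + cos(x/2), the 1 in [Q 1] removes the second cosine. *)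
  have -> : (Q 1%N).[2 * cos x] = 2 * cos x - (a 0%N + 1).
    by rewrite Q1 !hornerE.
  rewrite cossumS !c0 Q0 hornerC mulr1.
  have -> : (2^-1 - 0%:R) * x = x / 2 by field.
  have -> : (2^-1 - 1%:R + 2) * x = x + x / 2 by field.
  have -> : (- (0%:R * 2) - (2^-1 - 1%:R)) * x = x / 2 by field.
  have := cosM2 x (x / 2); have -> : x - x / 2 = x / 2 by field.
  by move=> /(canLR (addrK _)) <-; split=> //; ring.
have := congr1 (fun q => cos (x / 2) * q.[2 * cos x]) (QSS n).
rewrite /= !(hornerD, hornerZ, hornerM, hornerX) !mulrDr.
move=> /(canRL (addrK _)) /(canRL (addrK _)) ->.
rewrite ![cos _ * (_ * _)]mulrCA IHn IHSn.
rewrite cossumMcos [cossum x _ (p n.+2)]cossumS.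
have -> : 2^-1 - n.+2%:R + 2 = 2^-1 - n.+1%:R + 1 :> R by rewrite -!natr1; ring.
have -> : - (n.+1%:R * 2) - (2^-1 - n.+2%:R) = 2^-1 - n.+1%:R :> R.
  by rewrite -!natr1; field.
(* Let A and B be the sums of [p n] with shifts 1/2 - n and 3/2 - n. This rewrite gives A - a_n B
   and the next one B - a_n A; the first plus a_n times the second is (1 - a_n^2) A, the term with
   coefficient u_(n+1). *)
have -> : cossum x (2^-1 - n.+1%:R - 1) (p n.+1) =
   cossum x (2^-1 - n%:R) (p n) - a n * cossum x (2^-1 - n%:R + 1) (p n).
  rewrite cossumS; congr (cossum _ _ _ - _ * cossum _ _ _).
    by rewrite -!natr1; ring.
  by rewrite -!natr1; field.
have -> : cossum x (2^-1 - n.+1%:R) (p n.+1) =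
   cossum x (2^-1 - n%:R + 1) (p n) - a n * cossum x (2^-1 - n%:R) (p n).
  rewrite cossumS; congr (cossum _ _ _ - _ * cossum _ _ _).
    by rewrite -!natr1; ring.
  by rewrite -!natr1; field.
by ring.
Qed.

End CosineSums.

(** * Decreasing substitutions on open intervals *)

Section SubstitutionOpenInterval.
Local Open Scope classical_set_scope.
Local Open Scope ring_scope.
Context {R : realType}.
Notation mu := (@lebesgue_measure R).
Variables (F : R -> R) (a b : R).
Hypothesis ab : a < b.
Hypothesis F_decr : {in `[a, b] &, {homo F : x y /~ x < y}}.
Hypothesis F_derivable : forall x, derivable F x 1.
Hypothesis F'_cont : continuous (derive1 F).

Let F_cont : continuous F.
Proof. by move=> x; apply/differentiable_continuous/derivable1_diffP. Qed.

(** The denominator n + 2 ensures [a + d n <= b - d n] already for [n = 0]. *)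
Let d (n : nat) : R := (b - a) / n.+2%:R.

Let d_gt0 n : 0 < d n. Proof. by rewrite divr_gt0 ?subr_gt0. Qed.

Let d_lt n : d n *+ 2 <= b - a.
Proof.
rewrite /d -mulrnAl ler_pdivrMr // -mulr_natr ler_wpM2l ?ler_nat //.
by rewrite subr_ge0 ltW.
Qed.

Let d_decr m n : (m <= n)%N -> d n <= d m.
Proof.
move=> mn; rewrite ler_wpM2l ?subr_ge0 ?(ltW ab) //.
by rewrite lef_pV2 ?posrE // ler_nat.
Qed.

Let cvg_d : d n @[n --> \oo] --> (0 : R).
Proof.
rewrite -[0 : R](mulr0 (b - a)); apply: cvgMr.
have := @cvg_harmonic R; rewrite -(cvg_shiftS _) /=.
exact.
Qed.

Let ad_in n : a + d n \in `[a, b].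
Proof. rewrite in_itv /=; have := d_gt0 n; have := d_lt n; lra. Qed.

Let bd_in n : b - d n \in `[a, b].
Proof. rewrite in_itv /=; have := d_gt0 n; have := d_lt n; lra. Qed.

Let oo_bigcup : `]a, b[%classic = \bigcup_n `[a + d n, b - d n]%classic.
Proof.
apply/seteqP; split=> [x /=|x [n _] /=]; last first.
  by rewrite !in_itv /=; have := d_gt0 n; lra.
rewrite in_itv /= => /andP[ax xb].
have e0 : 0 < Num.min (x - a) (b - x) by rewrite lt_min !subr_gt0 ax.
have /cvgrPdist_lt /(_ _ e0) [n _ /(_ n (leqnn _))] := cvg_d.
rewrite sub0r normrN gtr0_norm // lt_min => /andP[h1 h2].
exists n => //=; rewrite in_itv /=; lra.
Qed.

Let image_bigcup :
  `]F b, F a[%classic = \bigcup_n `[F (b - d n), F (a + d n)]%classic.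
Proof.
apply/seteqP; split=> [x /=|x [n _] /=]; last first.
  rewrite !in_itv /= => /andP[h1 h2]; apply/andP; split.
    apply: lt_le_trans h1; apply: F_decr => //; last by have := d_gt0 n; lra.
    by rewrite in_itv /= lexx ltW.
  apply: le_lt_trans h2 _; apply: F_decr => //; last by have := d_gt0 n; lra.
  by rewrite in_itv /= lexx ltW.
rewrite in_itv /= => /andP[bx xa].
have cb : F (b - d n) @[n --> \oo] --> F b.
  apply: (@continuous_cvg _ _ _ _ _ (fun n => b - d n) F b); first exact: F_cont.
  by rewrite -[X in _ --> X]subr0; apply: cvgB => //; exact: cvg_cst.
have ca : F (a + d n) @[n --> \oo] --> F a.
  apply: (@continuous_cvg _ _ _ _ _ (fun n => a + d n) F a); first exact: F_cont.
  by rewrite -[X in _ --> X]addr0; apply: cvgD => //; exact: cvg_cst.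
have [n [h1 h2]] : exists n, F (b - d n) < x /\ x < F (a + d n).
  near \oo => n; exists n; split; near: n.
    exact: (cvgr_lt (F b) cb).
  exact: (cvgr_gt (F a) ca).
by exists n => //=; rewrite in_itv /= !ltW.
Unshelve. all: end_near. Qed.

Let derive_le0 x : x \in `]a, b[ -> derive1 F x <= 0.
Proof.
move=> xab; apply: (@decr_derive1_le0 _ F `[a, b]).
- by move=> y _; exact: F_derivable.
- by move=> y z; rewrite !inE /=; exact: F_decr.
- by rewrite interior_itv /= inE.
Qed.

Let comp_cont (G : R -> R) : {in `]F b, F a[, continuous G} ->
  {in `]a, b[, continuous (fun x => G (F x) * - derive1 F x)}.
Proof.
move=> cG x xab; apply: cvgM; last by apply: cvgN; exact: F'_cont.
apply: (@continuous_comp _ _ _ F G); first exact: F_cont.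
apply: cG; move: (xab); rewrite !in_itv /= => /andP[ax xb].
by apply/andP; split; apply: F_decr => //; rewrite in_itv /= ?lexx ?ltW.
Qed.

Let oo_measurable (c e : R) (G : R -> R) : {in `]c, e[, continuous G} ->
  measurable_fun `]c, e[ G.
Proof.
move=> cG; apply: open_continuous_measurable_fun => //.
by move=> x; rewrite inE; exact: cG.
Qed.

(* The library's substitution theorem needs [G] continuous up to the end
   points; exhaust the open interval by compact ones. *)
Lemma ge0_substitution_decreasing_oo (G : R -> R) :
  {in `]F b, F a[, continuous G} -> {in `]F b, F a[, forall x, 0 <= G x} ->
  (\int[mu]_(x in `]F b, F a[) (G x)%:E =
   \int[mu]_(x in `]a, b[) (G (F x) * - derive1 F x)%:E)%E.
Proof.
move=> cG G0.
have sJ n : `[F (b - d n), F (a + d n)]%classic `<=` `]F b, F a[%classic.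
  by rewrite image_bigcup => x ?; exists n.
have sI n : `[a + d n, b - d n]%classic `<=` `]a, b[%classic.
  by rewrite oo_bigcup => x ?; exists n.
have FG0 x : x \in `]a, b[ -> 0 <= G (F x) * - derive1 F x.
  move=> xab; rewrite mulr_ge0 ?oppr_ge0 ?derive_le0 // G0 //.
  move: (xab); rewrite !in_itv /= => /andP[ax xb].
  by apply/andP; split; apply: F_decr => //; rewrite in_itv /= ?lexx ?ltW.
(* Monotone convergence along the compact intervals, first for the image, then for the source. *)
have L : (\int[mu]_(x in `[F (b - d n), F (a + d n)]) (G x)%:E @[n --> \oo] -->
    \int[mu]_(x in `]F b, F a[) (G x)%:E)%E.
  rewrite [X in (\int[mu]_(x in X) _)%E]image_bigcup.
  apply: (@ge0_nondecreasing_set_cvg_integral _ (measurableTypeR R)).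
  - move=> m n mn; rewrite subsetEset; apply: subset_itv; rewrite bnd_simp.
      have [->//|mNn] := eqVneq (d m) (d n).
      by apply/ltW/F_decr => //; have := d_decr mn; have := mNn; lra.
    have [->//|mNn] := eqVneq (d m) (d n).
    by apply/ltW/F_decr => //; have := d_decr mn; have := mNn; lra.
  - by move=> n; exact: measurable_itv.
  - move=> n; apply/measurable_EFinP; apply: measurable_funS (sJ n) _ => //.
    exact: oo_measurable.
  - by move=> n x /sJ /= xJ; rewrite lee_fin G0.
have K : (\int[mu]_(x in `[(a + d n)%R, (b - d n)%R])
      (G (F x) * - derive1 F x)%:E
    @[n --> \oo] -->
    \int[mu]_(x in `]a, b[) (G (F x) * - derive1 F x)%:E)%E.
  rewrite [X in (\int[mu]_(x in X) _)%E]oo_bigcup.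
  apply: (@ge0_nondecreasing_set_cvg_integral _ (measurableTypeR R)).
  - move=> m n mn; rewrite subsetEset; apply: subset_itv; rewrite bnd_simp.
      by rewrite lerD2l d_decr.
    by rewrite lerD2l lerN2 d_decr.
  - by move=> n; exact: measurable_itv.
  - move=> n; apply/measurable_EFinP; apply: measurable_funS (sI n) _ => //.
    by apply: oo_measurable; exact: comp_cont.
  - by move=> n x /sI /= xI; rewrite lee_fin FG0.
(* Both sides are now limits over matching compact intervals, so equality for each [n] suffices. *)
rewrite -(cvg_lim (@ereal_hausdorff R) L) -(cvg_lim (@ereal_hausdorff R) K).
apply: congr_lim; apply/funext => n.
rewrite integration_by_substitution_decreasing //.
- by have := d_lt n; lra.
- move=> x y; rewrite !in_itv /= => hx hy; apply: F_decr; rewrite in_itv /=.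
    by have := d_gt0 n; lra.
  by have := d_gt0 n; lra.
- by apply: cvgP; apply: cvg_at_right_filter; exact: F'_cont.
- by apply: cvgP; apply: cvg_at_left_filter; exact: F'_cont.
- split; first by move=> x _; exact: F_derivable.
    by apply: cvg_at_right_filter; exact: F_cont.
  by apply: cvg_at_left_filter; exact: F_cont.
- by apply: continuous_in_subspaceT => x; rewrite inE => /sJ; exact: cG.
Qed.

(** Positive and negative parts are substituted separately; the factor -F' is nonnegative and
    commutes with taking them. *)
Lemma substitution_decreasing_oo (G : R -> R) :
  {in `]F b, F a[, continuous G} ->
  (\int[mu]_(x in `]F b, F a[) (G x)%:E =
   \int[mu]_(x in `]a, b[) (G (F x) * - derive1 F x)%:E)%E.
Proof.
have max_subst (H : R -> R) : {in `]F b, F a[, continuous H} ->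
    (\int[mu]_(x in `]F b, F a[) (Num.max (H x) 0)%:E =
     \int[mu]_(x in `]a, b[) (Num.max (H (F x) * - derive1 F x) 0)%:E)%E.
  move=> cH.
  rewrite (@ge0_substitution_decreasing_oo (fun x => Num.max (H x) 0));
    first last.
  - by move=> x _; rewrite le_max lexx orbT.
  - move=> x xFab; apply: (@continuous_max _ _ H (cst 0)); first exact: cH.
    exact: cst_continuous.
  apply: eq_integral => x; rewrite inE /= => xab; congr EFin.
  by rewrite maxr_pMl ?mul0r // oppr_ge0 derive_le0.
have posE (D : set R) (H : R -> R) :
    (\int[mu]_(x in D) (EFin \o H)^\+ x =
     \int[mu]_(x in D) (Num.max (H x) 0)%:E)%E.
  by apply: eq_integral => x _; rewrite funeposE EFin_max.
have negE (D : set R) (H : R -> R) :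
    (\int[mu]_(x in D) (EFin \o H)^\- x =
     \int[mu]_(x in D) (Num.max (- H x) 0)%:E)%E.
  by apply: eq_integral => x _; rewrite funenegE EFin_max.
move=> cG; rewrite [LHS]integralE [RHS]integralE !posE !negE.
congr (_ - _)%E; first exact: max_subst.
rewrite (max_subst (fun x => - G x)); last first.
  by move=> x xFab; apply: cvgN; exact: cG.
by apply: eq_integral => x _; rewrite mulNr.
Qed.

End SubstitutionOpenInterval.

(** * The substitutions y = cos(t/2) and t -> 2 pi - t *)

Section PuncturedIntervals.
Local Open Scope classical_set_scope.
Local Open Scope ring_scope.
Context {R : realType}.
Notation mu := (@lebesgue_measure R).

(** Points are null sets. Cutting at [b] isolates a possible singularity of the weight: 0 on the
    interval, [pi] on the circle. *)
Lemma integral_puncture (a b c : R) (f : R -> R) : a < b -> b < c ->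
  measurable_fun setT f ->
  (\int[mu]_(x in `[a, c]) (f x)%:E =
   \int[mu]_(x in `]a, b[) (f x)%:E + \int[mu]_(x in `]b, c[) (f x)%:E)%E.
Proof.
move=> ab bc mf.
have mfE (D : set R) : measurable_fun D (EFin \o f).
  by apply/measurable_EFinP; exact: measurable_funTS.
rewrite integral_itv_bndoo //.
rewrite (@itv_bndbnd_setU _ _ _ (BLeft b)) ?bnd_simp ?ltW //.
rewrite integral_setU //; [|exact: mfE|]; last first.
  apply/disj_setPS => y [/=]; rewrite 2!in_itv /= => /andP[_ yx] /andP[].
  by rewrite leNgt yx.
by congr (_ + _)%E; apply: integral_itv_bndoo; exact: mfE.
Qed.

Lemma is_derive_cos_half (x : R) :
  is_derive x (1 : R) (fun t : R => cos (t / 2)) (- (sin (x / 2) / 2)).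
Proof.
apply: is_derive_eq.
by rewrite /GRing.scale /=; ring.
Qed.

(** The map t -> cos(t/2) decreases from 1 to -1 on [0, 2 pi] and sends [pi] to 0, so the two
    punctures correspond. *)
Lemma integral_cos_half (G g : R -> R) :
  measurable_fun setT G -> measurable_fun setT g ->
  (forall x, x != 0 -> x \in `]-1, 1[ -> {for x, continuous G}) ->
  (forall t, t != pi -> t \in `]0, 2 * pi[ ->
     G (cos (t / 2)) * (sin (t / 2) / 2) = g t) ->
  (\int[mu]_(x in `[(-1)%R, 1%R]) (G x)%:E =
   \int[mu]_(t in `[0%R, (2 * pi)%R]) (g t)%:E)%E.
Proof.
move=> mG mg cG Gg.
have pi0 := pi_gt0 R.
pose F (t : R) := cos (t / 2).
have dF x : derivable F x 1 by have [] := is_derive_cos_half x.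
have F'E x : derive1 F x = - (sin (x / 2) / 2).
  by rewrite derive1E; have [_ <-] := is_derive_cos_half x.
have cF' : continuous (derive1 F).
  rewrite (_ : derive1 F = fun x => - (sin (x / 2) / 2)); last exact/funext.
  move=> x; apply: cvgN; apply: cvgMl.
  apply: (@continuous_comp R R R (fun x => x / 2) (@sin R));
    last exact: continuous_sin.
  by apply: cvgMl; exact: cvg_id.
have F_decr (x y : R) : 0 <= x -> y <= 2 * pi -> x < y -> F y < F x.
  by move=> x0 y2 xy; rewrite /F ltr_cos // ?in_itv /=; lra.
have F0 : F 0 = 1 by rewrite /F mul0r cos0.
have Fpi : F pi = 0 by rewrite /F cos_pihalf.
have F2pi : F (2 * pi) = -1.
  by rewrite /F (_ : 2 * pi / 2 = pi) ?cospi //; field.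
have subst a b : 0 <= a -> a < b -> b <= 2 * pi ->
    {in `]F b, F a[, forall x, x != 0 /\ x \in `]-1, 1[} ->
    (forall x, x \in `]a, b[ -> x != pi) ->
    (\int[mu]_(x in `]F b, F a[) (G x)%:E = \int[mu]_(t in `]a, b[) (g t)%:E)%E.
  move=> a0 ab b2 hF hpi; rewrite substitution_decreasing_oo //.
  - apply: eq_integral => t; rewrite inE /= => tab; congr EFin.
    rewrite F'E opprK Gg ?hpi //; move: tab; rewrite !in_itv /=; lra.
  - by move=> x y; rewrite !in_itv /= => hx hy; apply: F_decr; lra.
  - by move=> x /hF[x0 x1]; exact: cG.
rewrite (@integral_puncture _ 0) // ?ltrN10 //.
rewrite (@integral_puncture _ pi) //; [|lra].
(* The order is reversed: ]0, pi[ corresponds to ]0, 1[ and ]pi, 2 pi[ to ]-1, 0[. *)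
rewrite addeC -F2pi -F0 -Fpi !subst ?Fpi ?F2pi ?F0 //; try lra.
- by move=> x; rewrite F2pi !in_itv /= => hx; split; [apply/ltr0_neq0|]; lra.
- by move=> x; rewrite in_itv /= => hx; rewrite gt_eqF //; lra.
- by move=> x; rewrite !in_itv /= => hx; split; [apply/lt0r_neq0|]; lra.
- by move=> x; rewrite in_itv /= => hx; rewrite lt_eqF //; lra.
Qed.

(** The reflection fixes the puncture [pi] and exchanges the two halves. *)
Lemma integral_reflect (g : R -> R) :
  measurable_fun setT g ->
  (forall t, t != pi -> t \in `]0, 2 * pi[ -> {for t, continuous g}) ->
  (\int[mu]_(t in `[0%R, (2 * pi)%R]) (g t)%:E =
   \int[mu]_(t in `[0%R, (2 * pi)%R]) (g (2 * pi - t))%:E)%E.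
Proof.
move=> mg cg.
have pi0 := pi_gt0 R.
pose F (t : R) := 2 * pi - t.
have dFx (x : R) : is_derive x (1 : R) F (-1).
  by apply: is_derive_eq; rewrite add0r mul1r.
have dF x : derivable F x 1 by have [] := dFx x.
have F'E x : derive1 F x = -1 by rewrite derive1E; have [_ <-] := dFx x.
have cF' : continuous (derive1 F).
  rewrite (_ : derive1 F = cst (-1)); last exact/funext.
  exact: cst_continuous.
have subst a b : 0 <= a -> a < b -> b <= 2 * pi ->
    {in `]F b, F a[, forall x, x != pi} ->
    (\int[mu]_(x in `]F b, F a[) (g x)%:E =
     \int[mu]_(t in `]a, b[) (g (2 * pi - t))%:E)%E.
  move=> a0 ab b2 hpi; rewrite substitution_decreasing_oo //.
  - by apply: eq_integral => t _; rewrite F'E opprK mulr1.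
  - by move=> x y _ _; rewrite /F; lra.
  - move=> x hx; apply: cg; first exact: hpi.
    by move: hx; rewrite /F !in_itv /=; lra.
have pi2 : pi < 2 * pi :> R by lra.
rewrite (integral_puncture pi0 pi2 mg).
rewrite (@integral_puncture 0 pi (2 * pi) (fun t => g (2 * pi - t))) //;
  last first.
  by apply: measurableT_comp => //; apply: measurable_funB.
have F0 : F 0 = 2 * pi by rewrite /F subr0.
have Fpi : F pi = pi by rewrite /F; ring.
have F2pi : F (2 * pi) = 0 by rewrite /F subrr.
rewrite addeC; congr (_ + _)%E.
  rewrite -(subst 0 pi) ?F0 ?Fpi //; first lra.
  by move=> x; rewrite in_itv /= => hx; rewrite gt_eqF //; lra.
rewrite -(subst pi (2 * pi)) ?F2pi ?Fpi //; first lra.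
by move=> x; rewrite in_itv /= => hx; rewrite lt_eqF //; lra.
Qed.

End PuncturedIntervals.

(** * Cosine and sine moments of a symmetric weight *)

Section TrigonometricMoments.
Local Open Scope classical_set_scope.
Local Open Scope ring_scope.
Context {R : realType}.
Notation mu := (@lebesgue_measure R).
Notation D := (`[0, 2 * pi]%classic : set R).
Variable rho : R -> R.
Hypothesis rho_meas : measurable_fun setT rho.
Hypothesis rho_cont :
  forall t, t != pi -> t \in `]0, 2 * pi[ -> {for t, continuous rho}.
Hypothesis rho_sym : forall t, rho (2 * pi - t) = rho t.
Hypothesis rho_int : mu.-integrable D (EFin \o rho).

Lemma integrable_bounded_mul (h : R -> R) (C : R) : measurable_fun setT h ->
  (forall t, `|h t| <= C) -> mu.-integrable D (EFin \o (fun t => h t * rho t)).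
Proof.
move=> mh hC; have := @integrableMr _ _ _ mu D (measurable_itv _) h _
  (measurable_funTS mh) _ rho_int.
rewrite (_ : (_ \* _)%E = EFin \o (fun t => h t * rho t)); last first.
  by apply/funext => t; rewrite /= EFinM.
apply; exists C; split; first exact: num_real.
by move=> x Cx t _ /=; rewrite (le_trans (hC t)) // ltW.
Qed.

Let measurable_scale (x : R) : measurable_fun setT (fun t : R => x * t).
Proof. by apply: continuous_measurable_fun => t; apply: cvgMr; exact: cvg_id. Qed.

Lemma integrable_cos x :
  mu.-integrable D (EFin \o (fun t => cos (x * t) * rho t)).
Proof.
apply: (@integrable_bounded_mul _ 1) => [|t]; last exact: cos_max.
apply: (measurableT_comp (f := @cos R)); last exact: measurable_scale.
by apply: continuous_measurable_fun; exact: continuous_cos.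
Qed.

Lemma integrable_sin x :
  mu.-integrable D (EFin \o (fun t => sin (x * t) * rho t)).
Proof.
apply: (@integrable_bounded_mul _ 1) => [|t]; last exact: sin_max.
apply: (measurableT_comp (f := @sin R)); last exact: measurable_scale.
by apply: continuous_measurable_fun; exact: continuous_sin.
Qed.

(** Defined for every real order, since half-integral orders occur in the products of cosine
    sums. *)
Definition cos_moment x := \int[mu]_(t in D) (cos (x * t) * rho t).

Lemma cos_momentN x : cos_moment (- x) = cos_moment x.
Proof. by apply: eq_Rintegral => t _; rewrite mulNr cosN. Qed.

(** The reflection t -> 2 pi - t preserves [rho] and negates [h], so the integral equals its own
    opposite. *)
Lemma integral_antisymmetric (h : R -> R) : measurable_fun setT h ->
  continuous h -> (forall t, h (2 * pi - t) = - h t) ->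
  mu.-integrable D (EFin \o (fun t => h t * rho t)) ->
  \int[mu]_(t in D) (h t * rho t) = 0.
Proof.
move=> mh ch hN ih; set I := LHS; suff : I = - I by move=> II; lra.
rewrite {1}/I /Rintegral (integral_reflect (g := fun t => h t * rho t)).
- rewrite -mulN1r -RintegralZl //; congr fine.
  by apply: eq_integral => t _; rewrite hN rho_sym mulN1r mulNr.
- exact: measurable_funM.
- by move=> t tpi t02; apply: cvgM; [exact: ch|exact: rho_cont].
Qed.

Lemma natr_period_sin n (x : R) : sin (n%:R * (2 * pi) + x) = sin x.
Proof.
rewrite addrC -[in RHS](periodicn (@sinD2pi R) n x); congr sin.
by ring.
Qed.

Lemma natr_period_cos n (x : R) : cos (n%:R * (2 * pi) + x) = cos x.
Proof.
rewrite addrC -[in RHS](periodicn (@cosD2pi R) n x); congr cos.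
by ring.
Qed.

Let continuous_scale (f : R -> R) (x : R) :
  continuous f -> continuous (fun t : R => f (x * t)).
Proof.
move=> cf t; apply: (@continuous_comp R R R (fun t : R => x * t) f); last exact: cf.
by apply: cvgMr; exact: cvg_id.
Qed.

Lemma sin_moment_nat i j :
  \int[mu]_(t in D) (sin ((i%:R - j%:R) * t) * rho t) = 0.
Proof.
have cs := continuous_scale (x := i%:R - j%:R) (@continuous_sin R).
apply: (integral_antisymmetric (h := fun t => sin ((i%:R - j%:R) * t))) => //.
- exact: continuous_measurable_fun.
(* Adding [j] periods on one side and [i] on the other realizes the integer shift i - j with natural
   multiples only. *)
- move=> t; rewrite -sinN -[LHS](natr_period_sin j) -[RHS](natr_period_sin i).
  by congr sin; ring.
- exact: integrable_sin.
Qed.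

Lemma cos_moment_half i j : cos_moment (i%:R - j%:R + 2^-1) = 0.
Proof.
have cs := continuous_scale (x := i%:R - j%:R + 2^-1) (@continuous_cos R).
apply: (integral_antisymmetric
  (h := fun t => cos ((i%:R - j%:R + 2^-1) * t))) => //.
- exact: continuous_measurable_fun.
(* The extra 1/2 in the order contributes [pi] to the reflected angle, hence the change of sign. *)
- move=> t; rewrite -[LHS](natr_period_cos j) -cosDpi -[RHS]cosN.
  rewrite -[RHS](natr_period_cos i.+1).
  by congr cos; rewrite -natr1; field.
- exact: integrable_cos.
Qed.

Lemma Rintegral_sum n (f : 'I_n -> R -> R) :
  (forall i, mu.-integrable D (EFin \o f i)) ->
  \int[mu]_(t in D) (\sum_(i < n) f i t) = \sum_(i < n) \int[mu]_(t in D) f i t.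
Proof.
move=> hf; rewrite {1}/Rintegral.
under eq_integral do rewrite -sumEFin.
rewrite integral_sum // sum_fine // => i _.
by apply: integrable_fin_num; [exact: measurable_itv | exact: hf].
Qed.

Lemma integrable_sum_EFin n (f : 'I_n -> R -> R) :
  (forall i, mu.-integrable D (EFin \o f i)) ->
  mu.-integrable D (EFin \o (fun t => \sum_(i < n) f i t)).
Proof.
move=> hf.
rewrite (_ : _ \o _ = fun t => (\sum_(i < n) (f i t)%:E)%E); last first.
  by apply/funext => t; rewrite /= sumEFin.
by apply: integrable_sum => // i _; exact: hf.
Qed.

Let cossum_product (t r s : R) (p q : {poly R}) :
  cossum (t / 2) r p * cossum (t / 2) s q * rho t =
  \sum_(l < size q) \sum_(k < size p) q`_l * p`_k / 2 *
    (cos ((k%:R + l%:R + (r + s) / 2) * t) * rho t +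
     cos ((k%:R - l%:R + (r - s) / 2) * t) * rho t).
Proof.
rewrite mulrAC mulr_sumr; apply: eq_bigr => l _.
rewrite /cossum mulrAC !mulr_suml; apply: eq_bigr => k _.
rewrite -mulrDl.
have -> : cos ((k%:R + l%:R + (r + s) / 2) * t) +
  cos ((k%:R - l%:R + (r - s) / 2) * t) = 2 *
  (cos ((k%:R * 2 + r) * (t / 2)) * cos ((l%:R * 2 + s) * (t / 2))).
  by rewrite cosM2; congr (cos _ + cos _); field.
by field.
Qed.

Let mD : measurable (D : set (measurableTypeR R)).
Proof. exact: measurable_itv. Qed.

Let integrable_cosD (x y : R) : mu.-integrable D (EFin \o
  (fun t => cos (x * t) * rho t + cos (y * t) * rho t)).
Proof.
by apply: eq_integrable (integrableD mD (integrable_cos x) (integrable_cos y)).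
Qed.

Let integrable_cos_pair (c x y : R) : mu.-integrable D (EFin \o
  (fun t => c * (cos (x * t) * rho t + cos (y * t) * rho t))).
Proof. by apply: eq_integrable (integrableZl mD c (integrable_cosD x y)). Qed.

Lemma integrable_cossumM (r s : R) (p q : {poly R}) : mu.-integrable D
  (EFin \o (fun t => cossum (t / 2) r p * cossum (t / 2) s q * rho t)).
Proof.
under [X in EFin \o X]eq_fun do rewrite cossum_product.
by do 2 apply: integrable_sum_EFin => ?; exact: integrable_cos_pair.
Qed.

(** Each product of two cosines at t/2 splits into cosines of the sum and of the difference of the
    orders. *)
Lemma Rintegral_cossumM (r s : R) (p q : {poly R}) :
  \int[mu]_(t in D) (cossum (t / 2) r p * cossum (t / 2) s q * rho t) =
  2^-1 * \sum_(l < size q) q`_l *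
    (coefsum (fun k => cos_moment (k%:R + l%:R + (r + s) / 2)) p +
     coefsum (fun k => cos_moment (k%:R - l%:R + (r - s) / 2)) p).
Proof.
under eq_Rintegral do rewrite cossum_product.
rewrite Rintegral_sum => [|l]; last first.
  by apply: integrable_sum_EFin => k; exact: integrable_cos_pair.
rewrite mulr_sumr; apply: eq_bigr => l _.
rewrite Rintegral_sum => [|k]; last exact: integrable_cos_pair.
rewrite /coefsum -big_split mulrCA mulr_sumr mulr_sumr /=.
apply: eq_bigr => k _.
rewrite RintegralZl //.
rewrite RintegralD //; try exact: integrable_cos.
by rewrite -!/(cos_moment _); field.
Qed.

(** * Orthogonality of the cosine sums *)

Section Gram.
Variable p : nat -> {poly R}.
Hypothesis p_monic : forall n, p n \is monic.
Hypothesis size_p : forall n, size (p n) = n.+1.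
Hypothesis p_orth : forall n j, (j < n)%N -> toeplitz cos_moment (p n) j = 0.
Hypothesis p_norm : forall n, 0 < toeplitz cos_moment (p n) n.

(** Through [horner_cossum] this becomes the integral of cos(t/4)^2 Q_n Q_m rho(t), with Q_n and Q_m
    taken at 2 cos(t/2). *)
Let gram n m := \int[mu]_(t in D)
  (cossum (t / 2) (2^-1 - n%:R) (p n) * cossum (t / 2) (2^-1 - m%:R) (p m) *
   rho t).

Let coefsum_half n (f : nat -> R) :
  (forall k : nat, exists i j : nat, f k = i%:R - j%:R + 2^-1) ->
  coefsum (fun k => cos_moment (f k)) (p n) = 0.
Proof.
move=> hf; apply: big1 => k _; have [i [j ->]] := hf k.
by rewrite cos_moment_half mulr0.
Qed.

Let coefsum_toeplitz n j (f : nat -> R) : (forall k : nat, f k = k%:R - j%:R) ->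
  coefsum (fun k => cos_moment (f k)) (p n) = toeplitz cos_moment (p n) j.
Proof. by move=> hf; apply: eq_coefsum => k; rewrite hf. Qed.

(** The sums have order k + l - (m + e) + 1/2 and drop out; the differences have order k - (l +
    e). *)
Lemma gram_even m e : gram (m + e.*2) m =
  2^-1 * \sum_(l < m.+1) (p m)`_l * toeplitz cos_moment (p (m + e.*2)) (l + e).
Proof.
rewrite /gram Rintegral_cossumM size_p; congr (_ * _); apply: eq_bigr => l _.
rewrite coefsum_half => [|k].
  rewrite add0r (@coefsum_toeplitz _ (l + e)) // => k.
  by rewrite -muln2 !natrD natrM; field.
by exists (k + l)%N, (m + e)%N; rewrite -muln2 !natrD natrM; field.
Qed.

(** Here the sums have the integral order k - (m + e - l), and the differences drop out. *)
Lemma gram_odd m e : gram (m + e.*2.+1) m =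
  2^-1 * \sum_(l < m.+1)
    (p m)`_l * toeplitz cos_moment (p (m + e.*2.+1)) (m + e - l).
Proof.
rewrite /gram Rintegral_cossumM size_p; congr (_ * _); apply: eq_bigr => l _.
have lm : (l <= m + e)%N by have := ltn_ord l; lia.
rewrite [X in _ + X]coefsum_half => [|k].
  rewrite addr0 (@coefsum_toeplitz _ (m + e - l)) // => k.
  by rewrite natrB // -[e.*2.+1]addn1 -muln2 !natrD natrM; field.
(* The successor comes from k - l - e - 1/2 = k - (l + e + 1) + 1/2. *)
exists k, (l + e).+1; rewrite -[e.*2.+1]addn1 -[(l + e).+1]addn1 -muln2.
by rewrite !natrD natrM; field.
Qed.

(** With [l <= m], the exponents l + e (where e > 0) and m + e - l stay below [n], so [p n] is
    orthogonal to every power involved. *)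
Lemma gram_lt n m : (m < n)%N -> gram n m = 0.
Proof.
move=> mn; have := odd_double_half (n - m); case: (odd _) => /= ne.
  have -> : n = (m + (n - m)./2.*2.+1)%N by lia.
  rewrite gram_odd big1 ?mulr0 // => l _.
  by rewrite p_orth ?mulr0 //; have := ltn_ord l; lia.
have -> : n = (m + (n - m)./2.*2)%N by lia.
rewrite gram_even big1 ?mulr0 // => l _.
by rewrite p_orth ?mulr0 //; have := ltn_ord l; lia.
Qed.

Lemma gram_neq m n : m != n -> gram m n = 0.
Proof.
rewrite neq_ltn => /orP[mn|]; last exact: gram_lt.
rewrite -(gram_lt mn); apply: eq_Rintegral => t _.
by rewrite [X in X * _]mulrC.
Qed.

(** For e = 0 only the top term [l = n] survives, and it is half the squared norm of [p n]. *)
Lemma gram_gt0 n : 0 < gram n n.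
Proof.
have := gram_even n 0; rewrite addn0 => ->.
rewrite big_ord_recr big1 /= => [|l _]; last first.
  by rewrite addn0 p_orth ?mulr0.
rewrite add0r addn0 mulr_gt0 ?invr_gt0 // mulr_gt0 //.
by have /monicP := p_monic n; rewrite lead_coefE size_p /= => ->.
Qed.

End Gram.

End TrigonometricMoments.

(** * Scalar products on the circle in terms of cosine moments *)

Section CircleMoments.
Local Open Scope classical_set_scope.
Local Open Scope ring_scope.
Local Open Scope complex_scope.
Context {R : realType}.
Notation mu := (@lebesgue_measure R).
Notation D := (`[0, 2 * pi]%classic : set R).
Notation cRe := (@complex.Re R).
Notation cIm := (@complex.Im R).

Lemma Re_sum (I : Type) (r : seq I) (P : pred I) (F : I -> R[i]) :
  cRe (\sum_(i <- r | P i) F i) = \sum_(i <- r | P i) cRe (F i).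
Proof. by apply: (big_morph cRe) => [[? ?] [? ?]|]. Qed.

Lemma Im_sum (I : Type) (r : seq I) (P : pred I) (F : I -> R[i]) :
  cIm (\sum_(i <- r | P i) F i) = \sum_(i <- r | P i) cIm (F i).
Proof. by apply: (big_morph cIm) => [[? ?] [? ?]|]. Qed.

Lemma Re_mulr_real (z : R[i]) (x : R) : cRe (z * x%:C) = cRe z * x.
Proof. by case: z => a b /=; ring. Qed.

Lemma Im_mulr_real (z : R[i]) (x : R) : cIm (z * x%:C) = cIm z * x.
Proof. by case: z => a b /=; ring. Qed.

Lemma expiX (t : R) n : expi t ^+ n = expi (n%:R * t).
Proof.
elim: n => [|n IHn]; first by rewrite expr0 /expi mul0r cos0 sin0.
rewrite exprS IHn -natr1 mulrDl mul1r addrC /expi cosD sinD.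
by apply/eqP; rewrite eq_complex /=; apply/andP; split; apply/eqP; ring.
Qed.

Lemma expiX_conj (t : R) i j :
  expi t ^+ i * (expi t ^+ j)^*%C = expi ((i%:R - j%:R) * t).
Proof.
rewrite !expiX mulrBl /expi cosB sinB.
by apply/eqP; rewrite eq_complex /=; apply/andP; split; apply/eqP; ring.
Qed.

Variable rho : R -> R.
Hypothesis rho_meas : measurable_fun setT rho.
Hypothesis rho_cont :
  forall t, t != pi -> t \in `]0, 2 * pi[ -> {for t, continuous rho}.
Hypothesis rho_sym : forall t, rho (2 * pi - t) = rho t.
Hypothesis rho_int : mu.-integrable D (EFin \o rho).

Let circle_integrandE (p q : {poly R[i]}) t : circle_integrand rho p q t =
  \sum_(j < size q) \sum_(i < size p)
     (q`_j)^*%C * p`_i * (expi ((i%:R - j%:R) * t) * (rho t)%:C).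
Proof.
rewrite /circle_integrand !horner_coef rmorph_sum mulr_sumr mulr_suml.
apply: eq_bigr => j _; rewrite mulr_suml mulr_suml.
apply: eq_bigr => i _; rewrite -expiX_conj rmorphM /=; ring.
Qed.

Let mD : measurable (D : set (measurableTypeR R)).
Proof. exact: measurable_itv. Qed.

Let integrable_trig (a b x : R) : mu.-integrable D (EFin \o
  (fun t => a * (cos (x * t) * rho t) + b * (sin (x * t) * rho t))).
Proof.
have ic := integrableZl mD a (integrable_cos rho_int x).
have is_ := integrableZl mD b (integrable_sin rho_int x).
by apply: eq_integrable (integrableD mD ic is_).
Qed.

Let Rintegral_trig (a b : R) i j :
  \int[mu]_(t in D) (a * (cos ((i%:R - j%:R) * t) * rho t) +
     b * (sin ((i%:R - j%:R) * t) * rho t)) = a * cos_moment rho (i%:R - j%:R).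
Proof.
have ic := integrable_cos rho_int (i%:R - j%:R).
have is_ := integrable_sin rho_int (i%:R - j%:R).
rewrite RintegralD //; last 2 first.
- by apply: eq_integrable (integrableZl mD a ic).
- by apply: eq_integrable (integrableZl mD b is_).
by rewrite !RintegralZl // sin_moment_nat // mulr0 addr0.
Qed.

Let Re_term (z : R[i]) x t : cRe (z * (expi (x * t) * (rho t)%:C)) =
  cRe z * (cos (x * t) * rho t) + (- cIm z) * (sin (x * t) * rho t).
Proof. by case: z => a b; rewrite /expi /=; ring. Qed.

Let Im_term (z : R[i]) x t : cIm (z * (expi (x * t) * (rho t)%:C)) =
  cIm z * (cos (x * t) * rho t) + cRe z * (sin (x * t) * rho t).
Proof. by case: z => a b; rewrite /expi /=; ring. Qed.

(** Expand both polynomials in powers of [expi t]. The sine moments of integral order vanish by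
    symmetry, so the moment matrix is real. *)
Lemma cintegral_circle_integrand (p q : {poly R[i]}) :
  cintegral D (circle_integrand rho p q) =
  \sum_(j < size q) (q`_j)^*%C *
    \sum_(i < size p) p`_i * (cos_moment rho (i%:R - j%:R))%:C.
Proof.
have -> : \sum_(j < size q) (q`_j)^*%C *
    \sum_(i < size p) p`_i * (cos_moment rho (i%:R - j%:R))%:C =
  \sum_(j < size q) \sum_(i < size p)
    (q`_j)^*%C * p`_i * (cos_moment rho (i%:R - j%:R))%:C.
  apply: eq_bigr => j _; rewrite mulr_sumr.
  by apply: eq_bigr => i _; rewrite mulrA.
apply/eqP; rewrite eq_complex /cintegral /=; apply/andP; split; apply/eqP.
- under eq_Rintegral do rewrite circle_integrandE Re_sum.
  rewrite Re_sum.
  under eq_Rintegral do under eq_bigr do rewrite Re_sum.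
  under eq_Rintegral do under eq_bigr do under eq_bigr do rewrite Re_term.
  rewrite Rintegral_sum => [|j]; last first.
    by apply: integrable_sum_EFin => i; exact: integrable_trig.
  apply: eq_bigr => j _; rewrite Re_sum Rintegral_sum => [|i].
    by apply: eq_bigr => i _; rewrite Rintegral_trig Re_mulr_real.
  exact: integrable_trig.
- under eq_Rintegral do rewrite circle_integrandE Im_sum.
  rewrite Im_sum.
  under eq_Rintegral do under eq_bigr do rewrite Im_sum.
  under eq_Rintegral do under eq_bigr do under eq_bigr do rewrite Im_term.
  rewrite Rintegral_sum => [|j]; last first.
    by apply: integrable_sum_EFin => i; exact: integrable_trig.
  apply: eq_bigr => j _; rewrite Im_sum Rintegral_sum => [|i].
    by apply: eq_bigr => i _; rewrite Rintegral_trig Im_mulr_real.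
  exact: integrable_trig.
Qed.

End CircleMoments.

(** * Passage to real coefficients *)

Section RealPart.
Local Open Scope classical_set_scope.
Local Open Scope ring_scope.
Local Open Scope complex_scope.
Context {R : realType}.
Notation mu := (@lebesgue_measure R).
Notation D := (`[0, 2 * pi]%classic : set R).
Notation cRe := (@complex.Re R).

Variables (rho : R -> R) (Phi : nat -> {poly R[i]}).
Hypothesis rho_meas : measurable_fun setT rho.
Hypothesis rho_cont :
  forall t, t != pi -> t \in `]0, 2 * pi[ -> {for t, continuous rho}.
Hypothesis rho_sym : forall t, rho (2 * pi - t) = rho t.
Hypothesis Phi_orth : monic_orthogonal_circle rho Phi.

(** As [Phi 0] is 1, this is the real part of the integrability clause at m = n = 0. *)
Lemma circle_weight_integrable : mu.-integrable D (EFin \o rho).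
Proof.
have [monPhi iPhi _ _] := Phi_orth; have [+ _] := iPhi 0%N 0%N.
have [/monicP lPhi /eqP sPhi] := monPhi 0%N.
have Phi0 : Phi 0%N = 1.
  by have /size_poly1P [c _ Pc] := sPhi; move: lPhi; rewrite Pc lead_coefC => ->.
congr (integrable _ _ _); apply/funext => t.
by rewrite /= /circle_integrand Phi0 hornerC rmorph1 !mul1r.
Qed.

(** The moments being real, orthogonality to powers of z passes to the real parts of the
    coefficients. *)
Definition real_part n : {poly R} := \poly_(i < n.+1) cRe (Phi n)`_i.

Let coef_lead n : (Phi n)`_n = 1.
Proof.
have [monPhi _ _ _] := Phi_orth; have [/monicP + sPhi] := monPhi n.
by rewrite lead_coefE sPhi.
Qed.

Let size_Phi n : size (Phi n) = n.+1.
Proof. by have [monPhi _ _ _] := Phi_orth; have [] := monPhi n. Qed.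

Lemma size_real_part n : size (real_part n) = n.+1.
Proof. by rewrite size_poly_eq // coef_lead oner_neq0. Qed.

Lemma real_part_monic n : real_part n \is monic.
Proof.
by apply/monicP; rewrite lead_coefE size_real_part coef_poly ltnSn coef_lead.
Qed.

Let moment n j := \sum_(i < n.+1) (Phi n)`_i * (cos_moment rho (i%:R - j%:R))%:C.

Let toeplitz_real_part n j :
  toeplitz (cos_moment rho) (real_part n) j = cRe (moment n j).
Proof.
rewrite /toeplitz /coefsum size_real_part Re_sum; apply: eq_bigr => i _.
by rewrite Re_mulr_real coef_poly ltn_ord.
Qed.

Let cintegral_moment n m : cintegral D (circle_integrand rho (Phi n) (Phi m)) =
  \sum_(j < m.+1) ((Phi m)`_j)^*%C * moment n j.
Proof.
rewrite (cintegral_circle_integrand rho_meas rho_cont rho_sym) ?size_Phi //.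
exact: circle_weight_integrable.
Qed.

(** Strong induction on [j]: in the product of [Phi n] with [Phi j], the lower moments are already 0
    and the last has coefficient 1. *)
Let moment_eq0 n j : (j < n)%N -> moment n j = 0.
Proof.
have [_ _ orth _] := Phi_orth.
elim/ltn_ind: j => j IHj jn; have := orth n j; rewrite cintegral_moment gt_eqF //.
rewrite big_ord_recr big1 /= => [|k _]; last first.
  by rewrite IHj ?mulr0 // (ltn_trans _ jn).
by rewrite add0r coef_lead rmorph1 mul1r => ->.
Qed.

Lemma real_part_orth n j :
  (j < n)%N -> toeplitz (cos_moment rho) (real_part n) j = 0.
Proof. by move=> jn; rewrite toeplitz_real_part moment_eq0. Qed.

(** Only the top moment is left in the squared norm of [Phi n], and positivity in [R[i]] is
    positivity of the real part. *)
Lemma real_part_norm n : 0 < toeplitz (cos_moment rho) (real_part n) n.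
Proof.
have [_ _ _ norm] := Phi_orth; have := norm n.
rewrite cintegral_moment big_ord_recr big1 /= => [|k _]; last first.
  by rewrite moment_eq0 ?mulr0.
rewrite add0r coef_lead rmorph1 mul1r toeplitz_real_part ltcE => /andP[_].
exact.
Qed.

End RealPart.

(** * Regularity of the two weights and the relation between them *)

Section Weights.
Local Open Scope classical_set_scope.
Local Open Scope ring_scope.
Local Open Scope complex_scope.
Context {R : realType}.
Implicit Types (r x t alpha beta xi eta : R).

Lemma continuous_powR r x : 0 < x -> {for x, continuous (@powR R ^~ r)}.
Proof.
move=> x0; apply/differentiable_continuous/derivable1_diffP.
by apply: derivable_powR; rewrite in_itv /= x0.
Qed.

Lemma cos_gtN1 t : t != pi -> t \in `]0, 2 * pi[ -> -1 < cos t.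
Proof.
rewrite in_itv /= => tpi /andP[t0 t2].
have half : t = (t / 2) *+ 2 by rewrite -mulr_natr; field.
rewrite {1}half cos_mulr2n ltrBDr addrC subrr pmulrn_rgt0 // exprn_even_gt0 //=.
apply: contraNneq tpi => c0; apply/eqP.
have : t / 2 = pi / 2.
  apply: cos_inj; rewrite ?in_itv /=; first by lra.
    by have := pi_gt0 R; lra.
  by rewrite cos_pihalf c0.
lra.
Qed.

Lemma sin_half_gt0 t : t \in `]0, 2 * pi[ -> 0 < sin (t / 2).
Proof. by rewrite in_itv /= => ht; apply: sin_gt0_pi; lra. Qed.

Lemma cos_half_sqr t : 1 + cos t = 2 * cos (t / 2) ^+ 2.
Proof.
have {1}-> : t = (t / 2) *+ 2 by rewrite -mulr_natr; field.
by rewrite cos_mulr2n -[_ *+ 2]mulr_natl; ring.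
Qed.

Lemma sin_half_sqr t : 1 - cos t = 2 * sin (t / 2) ^+ 2.
Proof. by rewrite sin2cos2 mulrBr -cos_half_sqr; ring. Qed.

Lemma measurable_jacobi_circle_weight xi eta :
  measurable_fun setT (jacobi_circle_weight xi eta).
Proof.
have mc : measurable_fun setT (@cos R).
  by apply: continuous_measurable_fun; exact: continuous_cos.
apply: measurable_funM; apply: (measurableT_comp (measurable_powR _)).
  exact: measurable_funB.
exact: measurable_funD.
Qed.

Lemma continuous_jacobi_circle_weight xi eta t :
  t != pi -> t \in `]0, 2 * pi[ ->
  {for t, continuous (jacobi_circle_weight xi eta)}.
Proof.
move=> tpi t02.
have c1 : 0 < 1 - cos t.
  by rewrite sin_half_sqr mulr_gt0 // exprn_gt0 // sin_half_gt0.
have c2 : 0 < 1 + cos t by have := cos_gtN1 tpi t02; lra.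
apply: cvgM.
  apply: (@continuous_comp R R R (fun s => 1 - cos s) (@powR R ^~ _)).
    by apply: cvgB; [exact: cvg_cst | exact: continuous_cos].
  exact: continuous_powR.
apply: (@continuous_comp R R R (fun s => 1 + cos s) (@powR R ^~ _)).
  by apply: cvgD; [exact: cvg_cst | exact: continuous_cos].
exact: continuous_powR.
Qed.

Lemma jacobi_circle_weight_sym xi eta t :
  jacobi_circle_weight xi eta (2 * pi - t) = jacobi_circle_weight xi eta t.
Proof.
rewrite /jacobi_circle_weight.
have -> // : cos (2 * pi - t) = cos t.
rewrite -[RHS]cosN -[RHS](@cosD2pi R); congr cos.
by rewrite -mulr_natr; ring.
Qed.

Lemma measurable_little_m1_jacobi_weight alpha beta :
  measurable_fun setT (little_m1_jacobi_weight alpha beta).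
Proof.
apply: measurable_funM; [apply: measurable_funM|].
- exact: measurable_funD.
- apply: (measurableT_comp (measurable_powR _)).
  by apply: measurable_funB => //; exact: measurable_funX.
- apply: (measurableT_comp (measurable_powR _)).
  by apply: continuous_measurable_fun; exact: norm_continuous.
Qed.

Lemma continuous_little_m1_jacobi_weight alpha beta x :
  x != 0 -> x \in `]-1, 1[ ->
  {for x, continuous (little_m1_jacobi_weight alpha beta)}.
Proof.
move=> x0; rewrite in_itv /= => /andP[x1 x2].
apply: cvgM; [apply: cvgM|].
- by apply: cvgD; [exact: cvg_cst | exact: cvg_id].
- apply: (@continuous_comp R R R (fun s => 1 - s ^+ 2) (@powR R ^~ _)).
    apply: cvgB; [exact: cvg_cst | exact: exprn_continuous].
  by apply: continuous_powR; nra.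
- apply: (@continuous_comp R R R (fun s => `|s|) (@powR R ^~ _)).
    exact: norm_continuous.
  by apply: continuous_powR; rewrite normr_gt0.
Qed.

(** The powers of 2 come from 1 - cos t = 2 sin(t/2)^2 and 1 + cos t = 2 cos(t/2)^2, raised to
    alpha/2 and beta/2. *)
Definition weight_ratio alpha beta : R :=
  (2 `^ (alpha / 2) * 2 `^ (beta / 2))^-1.

Lemma weight_ratio_gt0 alpha beta : 0 < weight_ratio alpha beta.
Proof. by rewrite invr_gt0 mulr_gt0 ?powR_gt0. Qed.

(** With s = sin(t/2) and c = cos(t/2), both sides equal cos(t/4)^2 s^alpha |c|^beta: the factor 1 +
    c is 2 cos(t/4)^2, and 1 - c^2 is s^2. *)
Lemma little_m1_jacobi_weight_cos_half alpha beta xi eta t :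
  xi = (alpha - 1) / 2 -> eta = (beta - 1) / 2 ->
  t != pi -> t \in `]0, 2 * pi[ ->
  little_m1_jacobi_weight alpha beta (cos (t / 2)) * (sin (t / 2) / 2) =
  cos (t / 2 / 2) ^+ 2 *
  (weight_ratio alpha beta * jacobi_circle_weight xi eta t).
Proof.
move=> -> -> tpi t02; rewrite /little_m1_jacobi_weight /jacobi_circle_weight.
rewrite cos_half_sqr (cos_half_sqr t) sin_half_sqr -sin2cos2.
set s := sin (t / 2); set c := cos (t / 2).
have s0 : 0 < s by exact: sin_half_gt0.
have -> : (alpha - 1) / 2 + 2^-1 = alpha / 2 by field.
have -> : (beta - 1) / 2 + 2^-1 = beta / 2 by field.
have sE r : (s ^+ 2) `^ (r / 2) = s `^ r.
  by rewrite -powR_mulrn ?(ltW s0) // -powRrM; congr (_ `^ _); field.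
have cE : (c ^+ 2) `^ (beta / 2) = `|c| `^ beta.
  rewrite -real_normK ?num_real // -powR_mulrn // -powRrM.
  by congr (_ `^ _); field.
rewrite !(powRM _ (ler0n R 2) (sqr_ge0 _)) !sE cE.
(* The Jacobian s/2 supplies the missing power of s. *)
have -> : s `^ alpha = s `^ (alpha - 1) * s.
  by rewrite -{3}(powRr1 (ltW s0)) -powRD ?subrK // (gt_eqF s0) implybT.
rewrite /weight_ratio.
have p1 : 2 `^ (alpha / 2) != 0 :> R by rewrite gt_eqF // powR_gt0.
have p2 : 2 `^ (beta / 2) != 0 :> R by rewrite gt_eqF // powR_gt0.
by field; rewrite p1 p2.
Qed.

End Weights.

(** * Integrability under the half-angle substitution *)

Section Substitution.
Local Open Scope classical_set_scope.
Local Open Scope ring_scope.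
Context {R : realType}.
Notation mu := (@lebesgue_measure R).

(** The substitution is applied to absolute values; the Jacobian is positive on ]0, 2 pi[, so the
    pointwise relation persists. *)
Lemma integrable_cos_half (G g : R -> R) :
  measurable_fun setT G -> measurable_fun setT g ->
  (forall x, x != 0 -> x \in `]-1, 1[ -> {for x, continuous G}) ->
  (forall t, t != pi -> t \in `]0, 2 * pi[ ->
     G (cos (t / 2)) * (sin (t / 2) / 2) = g t) ->
  mu.-integrable `[0, 2 * pi]%classic (EFin \o g) ->
  mu.-integrable `[-1, 1]%classic (EFin \o G).
Proof.
move=> mG mg cG Gg /integrableP[_ fin]; apply/integrableP; split.
  by apply/measurable_EFinP; exact: measurable_funTS.
have norm_meas (h : R -> R) : measurable_fun setT h ->
    measurable_fun setT (fun x => `|h x|).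
  by move=> mh; apply: (measurableT_comp (f := @Num.norm R R)).
rewrite (@integral_cos_half _ (fun x => `|G x|) (fun t => `|g t|)) //.
- exact: norm_meas.
- exact: norm_meas.
- move=> x x0 x1; apply: (@continuous_comp R R R G (@Num.norm R R)).
    exact: cG.
  exact: norm_continuous.
- move=> t tpi t02; rewrite -Gg // normrM; congr (_ * _).
  by rewrite ger0_norm // divr_ge0 // ltW // sin_half_gt0.
Qed.

Lemma measurable_cos_scale (c : R) :
  measurable_fun setT (fun t : R => cos (c * t)).
Proof.
apply: continuous_measurable_fun => t.
apply: (@continuous_comp R R R (fun t : R => c * t) (@cos R)); last exact: continuous_cos.
by apply: cvgMr; exact: cvg_id.
Qed.

Lemma measurable_cossum (r : R) (p : {poly R}) :
  measurable_fun setT (fun t : R => cossum (t / 2) r p).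
Proof.
apply: measurable_sum => k; apply: measurable_funM => //.
rewrite (_ : (fun t => _) = fun t : R => cos ((k%:R * 2 + r) / 2 * t)).
  exact: measurable_cos_scale.
by apply/funext => t; congr cos; ring.
Qed.

End Substitution.

(** * Rescaling of the [Q n] and transfer of orthogonality to [-1, 1] *)

Lemma rescaled_monic_recurrence (R : numFieldType) (b u : nat -> R)
    (Q : nat -> {poly R}) :
  Q 0%N = 1 -> Q 1%N = 'X - (b 0%N)%:P ->
  (forall n, Q n.+2 + b n.+1 *: Q n.+1 + u n.+1 *: Q n = 'X * Q n.+1) ->
  forall n, 2 ^- n *: (Q n \Po (2 *: 'X)) \is monic /\
    size (2 ^- n *: (Q n \Po (2 *: 'X))) = n.+1.
Proof.
move=> Q0 Q1 QSS.
have QP n : Q n \is monic /\ size (Q n) = n.+1.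
  suff: (Q n \is monic /\ size (Q n) = n.+1) /\
    (Q n.+1 \is monic /\ size (Q n.+1) = n.+2) by case.
  elim: n => [|n [[mn sn] [mSn sSn]]].
    by rewrite Q0 Q1 monic1 size_poly1 monicXsubC size_XsubC.
  have QE : Q n.+2 = 'X * Q n.+1 + (- (b n.+1 *: Q n.+1 + u n.+1 *: Q n)).
    by rewrite -QSS -[Q n.+2 + _ + _]addrA addrK.
  have sX : size ('X * Q n.+1) = n.+3.
    by rewrite mulrC size_mulX ?sSn // -size_poly_gt0 sSn.
  (* The correction has lower degree, so ['X * Q n.+1] determines the leading term. *)
  have slt : (size (- (b n.+1 *: Q n.+1 + u n.+1 *: Q n))%R < size ('X * Q n.+1)%R)%N.
    rewrite sX size_polyN ltnS (leq_trans (size_polyD _ _)) // geq_max.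
    by rewrite !(leq_trans (size_scale_leq _ _)) ?sn ?sSn.
  split=> //; rewrite QE monicE lead_coefDl // size_polyDl // sX.
  by rewrite -monicE monicMl ?monicX.
move=> n; have [mQ sQ] := QP n.
have n2 : 2 ^- n != 0 :> R by rewrite invr_eq0 expf_neq0 // pnatr_eq0.
have s2X : size (2 *: 'X : {poly R}) = 2 by rewrite size_scale ?size_polyX // pnatr_eq0.
have sQ2 : size (Q n \Po (2 *: 'X)) = n.+1 by rewrite size_comp_poly2 // s2X.
split; last by rewrite size_scale.
(* Substituting 2X multiplies the leading coefficient by 2^n, which the prefactor cancels. *)
rewrite monicE lead_coefZ lead_coef_comp ?s2X // (monicP mQ) mul1r.
by rewrite lead_coefZ lead_coefX mulr1 sQ /= mulVf // expf_neq0 // pnatr_eq0.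
Qed.

Theorem mainTheorem2 (R : realType) (alpha beta : R)
  (halpha : -1 < alpha) (hbeta : -1 < beta)
  (xi eta : R) (hxi : xi = (alpha - 1) / 2) (heta : eta = (beta - 1) / 2)
  (Phi : nat -> {poly R[i]}) (hPhi : jacobi_circle xi eta Phi)
  (a : int -> R)
  (ha : forall n : nat, (a n%:Z)%:C = reflection_param Phi n)
  (ham1 : a (-1) = -1)
  (b u : nat -> R)
  (hb : forall n : nat, b n = a n%:Z - a (n%:Z - 1))
  (hu : forall n : nat, u n = 1 - a (n%:Z - 1) ^+ 2)
  (Q : nat -> {poly R})
  (hQ0 : Q 0%N = 1) (hQ1 : Q 1%N = 'X - (b 0%N)%:P)
  (hQ : forall n : nat, (1 <= n)%N ->
     Q n.+1 + b n *: Q n + u n *: Q n.-1 = 'X * Q n) :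
  little_m1_jacobi alpha beta
    (fun n : nat => 2 ^- n *: (Q n \Po (2 *: 'X))).
Proof.
set rho := jacobi_circle_weight xi eta.
pose p := real_part Phi.
have rho_meas := measurable_jacobi_circle_weight xi eta.
have rho_cont := continuous_jacobi_circle_weight (xi := xi) (eta := eta).
have rho_sym := jacobi_circle_weight_sym xi eta.
have rho_int := circle_weight_integrable hPhi.
have p_monic := real_part_monic hPhi.
have size_p := size_real_part hPhi.
have p_orth := real_part_orth rho_meas rho_cont rho_sym hPhi.
have p_norm := real_part_norm rho_meas rho_cont rho_sym hPhi.
have p0 : p 0%N = 1.
  have /eqP/size_poly1P [c _ pc] := size_p 0%N.
  by have /monicP := p_monic 0%N; rewrite /p pc lead_coefC => ->.
(* The constant coefficient of [p n.+1] is the real part of that of [Phi n.+1], which is -a_n by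
   [ha]; conjugation leaves real parts unchanged. *)
have pS n : p n.+1 = 'X * p n - a n%:Z *: reverse_poly n (p n).
  rewrite {1}/p (szego_recurrence (@cos_momentN _ _) p_monic size_p p_orth p_norm).
  congr (_ + _); rewrite -scaleNr; congr (_ *: _).
  rewrite coef_poly /= -horner_coef0.
  have := congr1 (@complex.Re R) (ha n); rewrite /reflection_param /=.
  by case: (Phi n.+1).[0] => x y /= ->; rewrite opprK.
have aS n : a (n.+1%:Z - 1) = a n%:Z by congr a; lia.
have QSS n : Q n.+2 + b n.+1 *: Q n.+1 + u n.+1 *: Q n = 'X * Q n.+1 by exact: hQ.
have cosQ n t : cos (t / 2 / 2) * (Q n).[2 * cos (t / 2)] =
    cossum (t / 2) (2^-1 - n%:R) (p n).
  apply: (horner_cossum (a := fun n => a n%:Z)) => //.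
    (* The convention a_(-1) = -1 gives b_0 = a_0 + 1. *)
    by rewrite hQ1 hb ham1 opprK.
  by move=> k; rewrite -QSS hb hu aS.
pose P n := 2 ^- n *: (Q n \Po (2 *: 'X)).
have PE n x : (P n).[x] = 2 ^- n * (Q n).[2 * x].
  by rewrite /P hornerZ horner_comp hornerZ hornerX.
(* This constant collects the two rescaling factors and the ratio of the weights. *)
pose K m n := 2 ^- m * 2 ^- n * weight_ratio alpha beta.
have K0 m n : 0 < K m n.
  by rewrite mulr_gt0 ?weight_ratio_gt0 // mulr_gt0 // invr_gt0 exprn_gt0.
pose G m n x := (P m).[x] * (P n).[x] * little_m1_jacobi_weight alpha beta x.
pose h m n t := cossum (t / 2) (2^-1 - m%:R) (p m) *
  cossum (t / 2) (2^-1 - n%:R) (p n) * rho t.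
(* The factor cos(t/4)^2 from the weight is shared out, one cos(t/4) to each polynomial, which turns
   both into cosine sums. *)
have Gh m n t : t != pi -> t \in `]0, 2 * pi[ ->
    G m n (cos (t / 2)) * (sin (t / 2) / 2) = K m n * h m n t.
  move=> tpi t02; rewrite /G -mulrA.
  rewrite (little_m1_jacobi_weight_cos_half hxi heta tpi t02).
  by rewrite /h -!cosQ !PE /K -/rho; ring.
have mG m n : measurable_fun setT (G m n).
  apply: measurable_funM; last exact: measurable_little_m1_jacobi_weight.
  by apply: measurable_funM; apply: continuous_measurable_fun; exact: continuous_horner.
have cG m n x : x != 0 -> x \in `]-1, 1[ -> {for x, continuous (G m n)}.
  move=> x0 x1; apply: cvgM; last exact: continuous_little_m1_jacobi_weight.
  by apply: cvgM; exact: continuous_horner.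
have mh m n : measurable_fun setT (fun t => K m n * h m n t).
  apply: measurable_funM => //; apply: measurable_funM => //.
  by apply: measurable_funM; exact: measurable_cossum.
have ih m n := integrable_cossumM rho_int (2^-1 - m%:R) (2^-1 - n%:R) (p m) (p n).
(* The Gram matrix on [-1, 1] is, entry by entry, a positive multiple of that of the cosine sums. *)
have integral_G m n : Rintegral (@lebesgue_measure R) `[-1, 1]%classic (G m n) =
    K m n * Rintegral (@lebesgue_measure R) `[0, 2 * pi]%classic (h m n).
  rewrite -RintegralZl //.
  congr fine; exact: integral_cos_half (mG m n) (mh m n) (@cG m n) (@Gh m n).
split.
- exact: (rescaled_monic_recurrence hQ0 hQ1 QSS).
- move=> m n; apply: (integrable_cos_half (mG m n) (mh m n) (@cG m n) (@Gh m n)).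
  by apply: eq_integrable (integrableZl _ (K m n) (ih m n)).
- move=> m n mn; rewrite -/(G m n _) [LHS]integral_G.
  by rewrite [X in _ * X]gram_neq ?mulr0.
- move=> n; rewrite [ltRHS]integral_G mulr_gt0 //.
  exact: gram_gt0.
Qed.
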